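(* For every integer $d>1$ and every $k\in\mathbb{N}$ there exists a positive constant $c(d,k)$ such that \[N_{Q,d}(k)=c(d,k)\,Q^2+O_{d,k}(Q\log Q)\] as $Q\rightarrow\infty$.
   Context: For $Q\in\mathbb{N}$ the Farey fractions of order $Q$ are $\mathcal{F}_Q=\{a/q\in\mathbb{Q}: 1\le q\le Q,\ 0<a\le q,\ (a,q)=1\}$, ordered increasingly in the unit interval, where $(a,q)$ denotes the greatest common divisor. For $d\in\mathbb{N}$ let $\mathcal{F}_{Q,d}=\{a/q\in\mathcal{F}_Q : (q,d)=1\}$ (fractions written in lowest terms with positive denominator). For $k\in\mathbb{N}$ define \[N_{Q,d}(k)=\#\left\{\tfrac{a}{q}<\tfrac{a'}{q'} \text{ consecutive in } \mathcal{F}_{Q,d} : qa'-aq'=k\right\}.\] The notation $O_{d,k}$ means the implied constant may depend on $d$ and $k$. *)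

(* Defs.v *)
From HB Require Import structures.
From mathcomp Require Import all_boot all_order all_algebra.
From mathcomp Require Import finmap.
From mathcomp Require Import all_classical all_reals all_analysis.

Set Implicit Arguments.
Unset Strict Implicit.
Unset Printing Implicit Defensive.

Import Order.TTheory GRing.Theory Num.Theory.

Local Open Scope fset_scope.
Local Open Scope ring_scope.

Definition farey (Q : nat) : {fset rat} :=
  [fset (a%:R / q%:R : rat) | q in iota 1 Q, a in iota 1 q & coprime a q].

(* [denq] is the positive denominator in lowest terms. *)
Definition farey_coprime (Q d : nat) : {fset rat} :=
  [fset x in farey Q | coprime `|denq x|%N d].

Definition consecutive (F : {fset rat}) (x y : rat) : bool :=
  [&& x \in F, y \in F, x < y & [forall z : F, ~~ (x < fsval z < y)]].

Definition farey_count (Q d k : nat) : nat :=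
  #|` [fset p in farey_coprime Q d `*` farey_coprime Q d |
        consecutive (farey_coprime Q d) p.1 p.2 &&
        (denq p.1 * numq p.2 - numq p.1 * denq p.2 == k%:Z)] |.

(* Main.v *)
Require Import Defs.
From mathcomp Require Import all_boot all_order all_algebra.
From mathcomp Require Import finmap zify ring lra.
From mathcomp Require Import all_classical all_reals all_analysis.
Import Order.TTheory GRing.Theory Num.Theory.
Import numFieldNormedType.Exports.
Set Implicit Arguments.
Unset Strict Implicit.
Unset Printing Implicit Defensive.
Local Open Scope classical_set_scope.
Local Open Scope ring_scope.

(* Write v = (q, a) for the fraction a/q. Two fractions v < v' with determinant k satisfy v' = k
   w - r v for a unique residue r in [1, k], prime to k, and a vector w = (b, c) with det(v, w)
   = 1, and modulo translations the pair is determined by r and the coprime pair (q, b). The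
   fractions between v and v' are the x v + y w with y > 0 and k x + r y > 0; whether one of
   them of denominator at most Q is prime to d can be tested on finitely many (x, y), and for
   those on (q, b) modulo d and on linear inequalities in (q, b, Q). So N_{Q,d}(k) is, up to
   O(Q) pairs near 1, a finite sum of numbers of coprime lattice points in a congruence class in
   the dilate by Q of a fixed polygon.

   For such a polygon, cutting the plane into square cells shows that the number F of lattice
   points satisfies F(m n) = m^2 F(n) + O(m^2 n), whence F(n) = L n^2 + O(n), each class modulo
   d receiving a proportion d^-2. Moebius inversion turns this into L' n^2 + O(n log n) for
   coprime points. Positivity comes from r = 1 and w of denominator divisible by d. *)

(** * Sums over boxes *)

Lemma sum_cells (V : nmodType) (m N : nat) (G : nat -> V) :
  \sum_(0 <= i < m * N) G i = \sum_(0 <= j < N) \sum_(0 <= i < m) G (m * j + i)%N.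
Proof.
elim: N => [|N IH]; first by rewrite muln0 !big_geq.
rewrite mulnSr (big_cat_nat (n := m * N)) ?leq_addr //= IH big_nat_recr //=.
by congr (_ + _); rewrite -{1}[(m * N)%N]add0n big_addn addKn; apply: eq_bigr => i _; rewrite addnC.
Qed.

Lemma sum_cell_corner (V : nmodType) (m N i0 : nat) (G : nat -> V) : (i0 < m)%N ->
  \sum_(0 <= i < m * N) (if (i %% m == i0)%N then G i else 0) = \sum_(0 <= j < N) G (m * j + i0)%N.
Proof.
move=> im; rewrite sum_cells; apply: eq_bigr => j _.
have E i : (i < m)%N -> ((m * j + i) %% m)%N = i by move=> h; rewrite mulnC modnMDl modn_small.
rewrite (big_rem i0) /=; last by rewrite mem_index_iota.
rewrite E // eqxx big_seq big1 ?addr0 // => i.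
rewrite mem_rem_uniq ?iota_uniq // inE mem_index_iota => /andP[/negbTE h1 /andP[_ h2]].
by rewrite E // h1.
Qed.

Lemma sum_nat_extend (V : nmodType) (m n : nat) (G : nat -> V) : (m <= n)%N ->
  (forall i, (m <= i)%N -> G i = 0) -> \sum_(0 <= i < n) G i = \sum_(0 <= i < m) G i.
Proof.
move=> mn G0; rewrite (big_cat_nat (n := m)) //= [X in _ + X]big_nat [X in _ + X]big1 ?addr0 //.
by move=> i /andP[/G0].
Qed.

Definition box (V : nmodType) (B : nat) (G : nat -> nat -> V) : V :=
  \sum_(0 <= q < B) \sum_(0 <= b < B) G q b.

Lemma eq_box (V : nmodType) (B : nat) (G H : nat -> nat -> V) :
  (forall q b, (q < B)%N -> (b < B)%N -> G q b = H q b) -> box B G = box B H.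
Proof.
move=> E; apply: eq_big_nat => q /andP[_ hq]; apply: eq_big_nat => b /andP[_ hb].
exact: E.
Qed.

Lemma box_extend (V : nmodType) (m n : nat) (G : nat -> nat -> V) : (m <= n)%N ->
  (forall q b, (m <= q)%N || (m <= b)%N -> G q b = 0) -> box n G = box m G.
Proof.
move=> mn G0; rewrite /box (sum_nat_extend mn) => [|q hq].
  by apply: eq_bigr => q _; rewrite (sum_nat_extend mn) // => b hb; rewrite G0 ?hb ?orbT.
by rewrite big1 // => b _; rewrite G0 ?hq.
Qed.

Lemma box_cells (V : nmodType) (m N : nat) (G : nat -> nat -> V) :
  box (m * N) G =
  box N (fun q b => box m (fun i j => G (m * q + i) (m * b + j)))%N.
Proof.
rewrite /box sum_cells; apply: eq_bigr => q _.
under eq_bigr => i _ do rewrite sum_cells.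
by rewrite exchange_big.
Qed.

Lemma box_corner (V : nmodType) (m N i j : nat) (G : nat -> nat -> V) :
  (i < m)%N -> (j < m)%N ->
  box (m * N) (fun q b => if (q %% m == i)%N && (b %% m == j)%N then G q b else 0) =
  box N (fun q b => G (m * q + i) (m * b + j))%N.
Proof.
move=> im jm; rewrite /box -(sum_cell_corner N (fun q => \sum_(0 <= b < N) G q (m * b + j)%N) im).
apply: eq_bigr => q _; case: eqP => [_|_] /=; last by rewrite big1.
by rewrite -(sum_cell_corner N (G q) jm).
Qed.

Lemma box_classes (V : nmodType) (m N : nat) (G : nat -> nat -> V) : (0 < m)%N ->
  box N G = box m (fun i j => box N (fun q b =>
    if (q %% m == i)%N && (b %% m == j)%N then G q b else 0)).
Proof.
move=> m0; rewrite /box.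
under [RHS]eq_bigr => i _.
  rewrite exchange_big /=; under eq_bigr => q _ do rewrite exchange_big /=.
  over.
rewrite [RHS]exchange_big /=; apply: eq_bigr => q _.
rewrite [RHS]exchange_big /=; apply: eq_bigr => b _.
have pick (x : V) c : (\sum_(0 <= i < m) (if (c %% m == i)%N then x else 0)) = x.
  have := sum_cell_corner 1 (fun=> x) (ltn_pmod c m0).
  rewrite muln1 big_nat1 => E; apply: etrans E.
  by apply: eq_big_nat => i /andP[_ hi]; rewrite (modn_small hi) eq_sym.
apply: etrans (esym (pick (G q b) q)) _; apply: eq_bigr => i _.
by case: (_ == i) => /=; [rewrite pick|rewrite big1].
Qed.

(** All solutions lie among the [D + 1] integers starting at the least one. *)
Lemma count_diameter (R : numDomainType) (p : nat -> bool) (D M : nat) :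
  (forall i j, p i -> p j -> (i <= j)%N -> (j <= i + D)%N) ->
  \sum_(0 <= i < M) (p i)%:R <= D.+1%:R :> R.
Proof.
move=> h; rewrite -natr_sum ler_nat -[X in (X <= _)%N]big_mkcond sum1_count -size_filter.
have [/hasP [i0 _ pi0]|] := boolP (has p (index_iota 0 M)); last first.
  by rewrite has_filter negbK => /eqP ->.
case: (ex_minnP (ex_intro _ i0 pi0)) => i pi imin.
rewrite -[D.+1](size_iota i); apply: uniq_leq_size; first exact/filter_uniq/iota_uniq.
move=> j; rewrite mem_filter mem_iota => /andP[pj _].
by rewrite imin //= addnS ltnS h ?imin.
Qed.

(** * Moebius function and elementary asymptotics *)

(** The test on [primes n] expresses squarefreeness. At 0 the value is 1, but sums over divisors may
    still start at 0, because 0 divides no positive integer. *)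
Definition mobius (n : nat) : int :=
  if all (fun p => logn p n == 1)%N (primes n) then (-1) ^+ size (primes n) else 0.

Lemma mobius_abs (R : numDomainType) (n : nat) : `|(mobius n)%:~R| <= 1 :> R.
Proof.
rewrite /mobius; case: all; last by rewrite normr0.
by rewrite rmorphXn /= normrX rmorphN1 normrN1 expr1n.
Qed.

Lemma mobius_prime_mul (p n : nat) : prime p -> (0 < n)%N ->
  mobius (p * n) = if (p %| n)%N then 0 else - mobius n.
Proof.
move=> pp n0; have p0 := prime_gt0 pp; have pn0 : (0 < p * n)%N by rewrite muln_gt0 p0.
case: ifPn => pn.
  rewrite /mobius; case: ifPn => // /allP /(_ p).
  rewrite mem_primes pp pn0 dvdn_mulr //= lognM // logn_prime // eqxx => /(_ isT) /eqP.
  have : (0 < logn p n)%N by rewrite logn_gt0 mem_primes pp n0 pn.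
  by case: (logn p n).
have pr : perm_eq (primes (p * n)) (p :: primes n).
  apply: uniq_perm; rewrite ?primes_uniq //=.
    by rewrite primes_uniq mem_primes (negbTE pn) !andbF.
  by move=> q; rewrite primesM // primes_prime // !inE.
rewrite /mobius (perm_all _ pr) (perm_size pr) /= lognM // logn_prime // eqxx.
rewrite lognE (negbTE pn) !andbF /= exprS mulN1r.
have -> : all (fun q => logn q (p * n) == 1)%N (primes n) =
          all (fun q => logn q n == 1)%N (primes n).
  apply: eq_in_all => q; rewrite mem_primes => /and3P[pq _ qn].
  rewrite lognM // logn_prime //; case: (q =P p) => // E.
  by rewrite -E qn in pn.
by case: all; rewrite ?oppr0.
Qed.

(** With p the least prime factor of [n], the divisors e and p e with p not dividing e cancel, and
    the multiples of p^2 contribute 0. *)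
Lemma sum_mobius (n N : nat) : (0 < n <= N)%N ->
  \sum_(0 <= e < N.+1) (if (e %| n)%N then mobius e else 0) = (n == 1)%:R.
Proof.
move=> /andP[n0 nN].
have out e : (n < e)%N -> (if (e %| n)%N then mobius e else 0) = 0.
  by move=> ne; case: ifP => // /(dvdn_leq n0); rewrite leqNgt ne.
rewrite (sum_nat_extend (m := n.+1) _ out) //.
have [->|n1] := eqVneq n 1%N.
  by rewrite big_nat_recr //= big_nat1 /mobius /= add0r.
set p := pdiv n; have pp : prime p by apply: pdiv_prime; rewrite ltn_neqAle eq_sym n1.
have p0 := prime_gt0 pp.
pose g e := if (e %| n)%N then mobius e else 0.
(* The range is lengthened to p (n + 1) so that its multiples of p are the p e with e <= n. *)
rewrite -(sum_nat_extend (n := p * n.+1) (G := g) _ out); last by rewrite leq_pmull.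
rewrite (eq_bigr (fun e => (if (e %% p == 0)%N then g e else 0) +
                           (if (e %% p == 0)%N then 0 else g e))); last first.
  by move=> e _; case: ifP; rewrite ?addr0 ?add0r.
rewrite big_split /= sum_cell_corner //.
rewrite [X in _ + X](sum_nat_extend (m := n.+1)); first last.
- by move=> e /out; rewrite /g => ->; case: ifP.
- by rewrite leq_pmull.
rewrite -big_split /= big1 // => e _; rewrite addn0 /g.
have -> : (e %% p == 0)%N = (p %| e)%N by [].
have [->|e0] := posnP e; first by rewrite muln0 dvd0n (gtn_eqF n0) dvdn0 addr0.
rewrite mobius_prime_mul //; case: (boolP (p %| e)%N) => pe.
  by rewrite if_same.
have -> : (p * e %| n)%N = (e %| n)%N.
  rewrite Gauss_dvd ?pdiv_dvd //.
  by rewrite prime_coprime.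
by case: ifP; rewrite ?addr0 // addNr.
Qed.

Lemma sum_mobius_coprime (a b N : nat) : (0 < a <= N)%N ->
  (coprime a b)%:R =
  \sum_(0 <= e < N.+1) (if (e %| a)%N && (e %| b)%N then mobius e else 0).
Proof.
move=> /andP[a0 aN]; rewrite -(sum_mobius (n := gcdn a b) (N := N)).
  by apply: eq_bigr => e _; rewrite dvdn_gcd.
by rewrite gcdn_gt0 a0 (leq_trans (dvdn_leq a0 (dvdn_gcdl a b))).
Qed.

Section Asymptotics.
Variable R : realType.
Implicit Types (u g : nat -> R) (c C : R).

(* With [L] the supremum of the lower bounds [u n - C / n], the hypothesis says that every upper
   bound [u m + C / m] dominates it. *)
Lemma harmonic_limit u C :
  (forall m n, (0 < m)%N -> (0 < n)%N -> u n - C / n%:R <= u m + C / m%:R) ->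
  exists L, forall n, (0 < n)%N -> `|u n - L| <= C / n%:R.
Proof.
move=> h; pose E := [set x | exists2 n, (0 < n)%N & x = u n - C / n%:R]%classic.
have ubE m : (0 < m)%N -> ubound E (u m + C / m%:R).
  by move=> m0 _ [n n0 ->]; exact: h.
exists (sup E) => n n0; rewrite ler_distl; apply/andP; split.
  rewrite lerBlDr; apply: ge_sup; last exact: ubE.
  by exists (u 1%N - C / 1%:R), 1%N.
rewrite -lerBlDr; apply: ub_le_sup; last by exists n.
by exists (u 1%N + C / 1%:R); exact: ubE.
Qed.

(** The bound telescopes: 1/(n+1)^2 falls short of 1/n - 1/(n+1) by 1/(n (n+1)^2). *)
Lemma sum_inv_sqr_tail (m n : nat) : (0 < m <= n)%N ->
  \sum_(m.+1 <= e < n.+1) (e%:R ^- 2 : R) <= m%:R^-1 - n%:R^-1.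
Proof.
move=> /andP[m0]; elim: n => [|n IH]; first lia.
rewrite leq_eqVlt => /predU1P[<-|mn]; first by rewrite big_geq // subrr.
rewrite ltnS in mn; rewrite big_nat_recr ?ltnS //=.
apply: le_trans (lerD (IH mn) (lexx _)) _.
have n0 : 0 < n%:R :> R by rewrite ltr0n; lia.
have -> : n.+1%:R = n%:R + 1 :> R by rewrite -natr1.
set x := n%:R in n0 *; set y := m%:R^-1.
have x1 : 0 < x + 1 by lra.
have -> : y - x^-1 + (x + 1) ^- 2 = y - (x + 1)^-1 - (x * (x + 1) ^+ 2)^-1.
  by field; rewrite !lt0r_neq0.
by rewrite lerBlDr lerDl invr_ge0; nra.
Qed.

(** Each step uses 1/(n+1) <= ln (n+1) - ln n, which is ln (1 + x) <= x at x = -1/(n+1). *)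
Lemma harmonic_sum_ln (n : nat) : (0 < n)%N ->
  \sum_(1 <= e < n.+1) (e%:R^-1 : R) <= 1 + ln n%:R.
Proof.
elim: n => // n IH _; rewrite big_nat_recr //=.
have [->|n0] := posnP n; first by rewrite big_geq // ln1 invr1; lra.
have n0' : 0 < n%:R :> R by rewrite ltr0n.
have n1 : 0 < n.+1%:R :> R by rewrite ltr0n.
have : n.+1%:R^-1 <= ln n.+1%:R - ln n%:R :> R.
  have := @le_ln1Dx R (- n.+1%:R^-1).
  have -> : 1 + - n.+1%:R^-1 = n%:R / n.+1%:R :> R.
    by rewrite -natr1; field; rewrite natr1; lra.
  rewrite lnM ?posrE ?invr_gt0 // lnV ?posrE // ltrN2 invf_lt1 // ltr1n ltnS => /(_ n0).
  by rewrite -lerN2 opprK opprB.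
by move=> H; apply: le_trans (lerD (IH n0) H) _; rewrite -addrA lerD2l addrC subrK.
Qed.

End Asymptotics.

(** * Lattice points in dilated polygons *)

Definition form (t : int * int * bool) (q b : nat) : int := t.1.1 * q%:Z + t.1.2 * b%:Z.

(** A half-plane whose boundary passes through the origin or is dilated with [n], according to
    whether the boolean is false or true. *)
Definition atom (t : int * int * bool) (n q b : nat) : bool :=
  form t q b <= (t.2 * n)%N%:Z.

(** These are the lattice points in [n] times a bounded polygonal region. Dependence on the truth
    values of finitely many half-planes treats open, closed and non-convex regions alike. The first
    clause makes every boundary a genuine line. *)
Definition homogeneous (s : seq (int * int * bool)) (P : nat -> nat -> nat -> bool) :=
  [/\ {in s, forall t, (t.1.1 != 0) || (t.1.2 != 0)},
      forall n q b n' q' b',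
        {in s, forall t, atom t n q b = atom t n' q' b'} -> P n q b = P n' q' b' &
      forall n q b, P n q b -> (0 < q <= n)%N && (b < 3 * n)%N].

(** For an integer x of either sign, e x <= n is equivalent to x <= n/e rounded down, so scaling is
    exact. *)
Lemma atom_scale t (e n q b : nat) : (0 < e)%N ->
  atom t n (e * q) (e * b) = atom t (n %/ e) q b.
Proof.
move=> e0; rewrite /atom.
have -> : form t (e * q) (e * b) = e%:Z * form t q b by rewrite /form !PoszM; ring.
case: (form t q b) => x; last first.
  have h : e%:Z * Negz x <= 0 by rewrite pmulr_rle0 // ltz_nat.
  by rewrite (le_trans h) // (@le_trans _ _ 0).
case: t.2; rewrite ?mul1n ?mul0n -PoszM !lez_nat ?leq_divRL 1?mulnC //.
by rewrite !leqn0 muln_eq0 (gtn_eqF e0) orbF.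
Qed.

Lemma homogeneous_scale s P (e n q b : nat) : homogeneous s P -> (0 < e)%N ->
  P n (e * q)%N (e * b)%N = P (n %/ e)%N q b.
Proof. by move=> [_ h _] e0; apply: h => t _; exact: atom_scale. Qed.

Definition height (t : int * int * bool) : nat := `|t.1.1| + `|t.1.2|.

(** Only for such (q, b) can the boundary line separate two points of the cell of side [m] with
    corner m (q, b), because [form] differs on the cell from its corner value by at most
    [m * height t]. *)
Definition near_boundary t (m n q b : nat) : bool :=
  `|m%:Z * form t q b - (t.2 * n)%N%:Z| <= (m * height t)%N%:Z.

Lemma form_bound t (m i j : nat) : (i < m)%N -> (j < m)%N ->
  `|form t i j| <= (m * height t)%N%:Z.
Proof.
move=> im jm; rewrite /form /height PoszM PoszD !abszE.
apply: le_trans (ler_normD _ _) _; rewrite !normrM.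
have h (x : int) (k : nat) : (k < m)%N -> `|x| * `|k%:Z| <= m%:Z * `|x|.
  by move=> km; rewrite mulrC ler_wpM2r // lez_nat ltnW.
by rewrite mulrDr lerD ?h.
Qed.

Lemma atom_cell t (m n q b i j i' j' : nat) :
  (i < m)%N -> (j < m)%N -> (i' < m)%N -> (j' < m)%N -> ~~ near_boundary t m n q b ->
  atom t n (m * q + i) (m * b + j) = atom t n (m * q + i') (m * b + j').
Proof.
move=> im jm im' jm'; rewrite /near_boundary /atom.
have E k l : form t (m * q + k) (m * b + l) = m%:Z * form t q b + form t k l.
  by rewrite /form !PoszD !PoszM; ring.
rewrite !E; have := form_bound t im jm; have := form_bound t im' jm'; lia.
Qed.

(** The values m (x + y b) for consecutive b are at least m apart, so at most 2 H + 1 of them lie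
    within m H of c. *)
Lemma near_boundary_line (R : numDomainType) (m x y c : int) (H M : nat) :
  0 < m -> y != 0 ->
  \sum_(0 <= b < M) (`|m * (x + y * b%:Z) - c| <= m * H%:Z)%R%:R <= (2 * H).+1%:R :> R.
Proof.
move=> m0 y0; apply: count_diameter => i j hi hj ij.
have h : m * (`|y| * (j%:Z - i%:Z)) <= m * (2 * H%:Z).
  have ji : 0 <= j%:Z - i%:Z by lia.
  rewrite -(ger0_norm ji) -normrM -[X in X * _](gtr0_norm m0) -normrM.
  have -> : m * (y * (j%:Z - i%:Z)) = (m * (x + y * j%:Z) - c) - (m * (x + y * i%:Z) - c) by ring.
  by apply: le_trans (ler_normB _ _) _; apply: le_trans (lerD hj hi) _; rewrite le_eqVlt; apply/orP; left; apply/eqP; ring.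
rewrite ler_pM2l // in h.
have : 1 * (j%:Z - i%:Z) <= `|y| * (j%:Z - i%:Z) by rewrite ler_wpM2r; lia.
lia.
Qed.

(** Summation first runs along a coordinate with nonzero coefficient, where each of the [M] parallel
    lines contains boundedly many cells near the boundary. *)
Lemma near_boundary_count (R : numDomainType) t (m n M : nat) :
  (0 < m)%N -> (t.1.1 != 0) || (t.1.2 != 0) ->
  box M (fun q b => (near_boundary t m n q b)%:R) <= (2 * height t).+1%:R * M%:R :> R.
Proof.
move=> m0 t0; rewrite /box mulr_natr -[X in _ *+ X]subn0 -sumr_const_nat.
rewrite /near_boundary /form PoszM.
case/orP: t0 => y0; first rewrite exchange_big /=; apply: ler_sum => k _.
  under eq_bigr => i _ do rewrite [t.1.1 * _ + _]addrC.
  exact: near_boundary_line.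
exact: near_boundary_line.
Qed.

Section Counting.
Variable R : realType.
Variables (s : seq (int * int * bool)) (P : nat -> nat -> nat -> bool).
Hypothesis hP : homogeneous s P.

Definition count_box (n : nat) : R := box (3 * n) (fun q b => (P n q b)%:R).

Lemma box_count (n B : nat) : (3 * n <= B)%N ->
  box B (fun q b => (P n q b)%:R : R) = count_box n.
Proof.
move=> nB; apply: box_extend => // q b h; case: hP => _ _ /(_ n q b).
by case: (P n q b) => // /(_ isT); lia.
Qed.

Definition boundary_const : R := 3 * \sum_(t <- s) (2 * height t).+1%:R.

Lemma boundary_const_ge0 : 0 <= boundary_const.
Proof. by rewrite mulr_ge0 // sumr_ge0. Qed.

Lemma cell_diff (m n q b i j i' j' : nat) :
  (i < m)%N -> (j < m)%N -> (i' < m)%N -> (j' < m)%N ->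
  `|(P n (m * q + i)%N (m * b + j)%N)%:R - (P n (m * q + i')%N (m * b + j')%N)%:R|
    <= \sum_(t <- s) (near_boundary t m n q b)%:R :> R.
Proof.
move=> im jm im' jm'.
have [/hasP[t ts ht]|/hasPn no] := boolP (has (fun t => near_boundary t m n q b) s).
  apply: (@le_trans _ _ 1).
    by case: (P _ _ _); case: (P _ _ _); rewrite ?subrr ?subr0 ?sub0r ?normrN ?normr0 ?normr1.
  by rewrite (big_rem t) //= ht lerDl sumr_ge0.
case: hP => _ h _; rewrite (h n (m * q + i) (m * b + j) n (m * q + i') (m * b + j'))%N.
  by rewrite subrr normr0 sumr_ge0.
by move=> t /no ht; exact: atom_cell.
Qed.

(** A cell away from the boundaries contributes m^2 times the value of [P] at any of its points, and
    only O(M) cells are exceptional. The free choice of the sample point (i, j) serves twice: (0, 0)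
    compares dilates, and general (i, j) compares residue classes. *)
Lemma cell_count (m n M i j : nat) : (0 < M)%N ->
  (i < m)%N -> (j < m)%N -> (n <= m * M)%N ->
  `|count_box n - m%:R ^+ 2 * box (3 * M) (fun q b => (P n (m * q + i)%N (m * b + j)%N)%:R)|
    <= m%:R ^+ 2 * (boundary_const * M%:R).
Proof.
move=> M0 im jm nM; rewrite -(@box_count n (m * (3 * M))); last lia.
have boxC B (x : R) : box B (fun _ _ => x) = B%:R ^+ 2 * x.
  by rewrite /box !sumr_const_nat !subn0 -mulrnA -natrX -mulnn mulr_natl.
have boxS B (G : nat -> nat -> R) x : x * box B G = box B (fun q b => x * G q b).
  by rewrite /box mulr_sumr; apply: eq_bigr => q _; rewrite mulr_sumr.
have boxB B (G H : nat -> nat -> R) : box B G - box B H = box B (fun q b => G q b - H q b).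
  by rewrite /box -sumrB; apply: eq_bigr => q _; rewrite -sumrB.
have boxN B (G H : nat -> nat -> R) : (forall q b, (q < B)%N -> (b < B)%N -> `|G q b| <= H q b) ->
    `|box B G| <= box B H.
  move=> h; rewrite /box; apply: le_trans (ler_norm_sum _ _ _) _.
  rewrite !big_nat; apply: ler_sum => q /andP[_ hq].
  apply: le_trans (ler_norm_sum _ _ _) _.
  by rewrite !big_nat; apply: ler_sum => b /andP[_ hb]; exact: h.
rewrite box_cells boxS boxB.
apply: le_trans (boxN _ _ (fun q b => m%:R ^+ 2 *
   \sum_(t <- s) (near_boundary t m n q b)%:R) _) _.
  move=> q b _ _; rewrite -!boxC boxB; apply: boxN => k l hk hl.
  exact: cell_diff.
rewrite -boxS ler_wpM2l ?exprn_ge0 //.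
rewrite /box; under eq_bigr => q _ do rewrite exchange_big /=.
rewrite exchange_big /= /boundary_const mulr_sumr mulr_suml !big_seq.
apply: ler_sum => t ts; case: hP => /(_ t ts) t0 _ _.
apply: le_trans (near_boundary_count _ _ _ _ t0) _; first lia.
by rewrite natrM mulrCA mulrA.
Qed.

End Counting.

Lemma modn_mul_inv (e d i : nat) : coprime e d -> (i < d)%N ->
  exists2 i', (i' < d)%N & forall q, ((e * q) %% d == i)%N = (q %% d == i')%N.
Proof.
move=> ed id; have d0 : (0 < d)%N by lia.
have [e' he] : exists e', (e * e' = 1 %[mod d])%N.
  have [e0|e0] := posnP e; first by exists 0%N; move: ed; rewrite e0 /coprime gcd0n => /eqP ->; rewrite !modn1.
  have /(coprimeP d e0)[[u v] /= h] := ed; exists u.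
  by rewrite -(modnMDl v 1 d); congr (_ %% _)%N; lia.
exists ((e' * i) %% d)%N; first exact: ltn_pmod.
move=> q; rewrite -[X in (_ == X)%N = _](modn_small id).
apply/eqP/eqP => h.
  by rewrite -modnMmr -h modnMmr mulnA -modnMml [(e' * e)%N]mulnC he modnMml mul1n.
by rewrite -modnMmr h !modnMmr mulnA -modnMml he modnMml mul1n.
Qed.

Section Density.
Variable R : realType.
Variables (s : seq (int * int * bool)) (P : nat -> nat -> nat -> bool).
Hypothesis hP : homogeneous s P.
Local Notation F := (count_box R P).
Local Notation K := (boundary_const R s).

Lemma density : exists L : R, forall n, `|F n - L * n%:R ^+ 2| <= K * n%:R.
Proof.
pose u n := F n / n%:R ^+ 2.
have up n : (0 < n)%N -> 0 < n%:R :> R by rewrite ltr0n.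
(* Sampling cells of side m at their corners turns the count for m n into m^2 times the count for n,
   up to the boundary error. *)
have scale m n : (0 < m)%N -> (0 < n)%N -> `|u (m * n)%N - u n| <= K / n%:R.
  move=> m0 n0; have := cell_count R hP n0 m0 m0 (leqnn (m * n)%N).
  have -> : box (3 * n) (fun q b => (P (m * n)%N (m * q + 0)%N (m * b + 0)%N)%:R) = F n.
    by apply: eq_box => q b _ _; rewrite !addn0 (homogeneous_scale _ _ _ hP) // mulKn.
  rewrite /u natrM; have := up _ m0; have := up _ n0.
  move: (m%:R : R) (n%:R : R) (F (m * n)%N) (F n) => x y a b y0 x0 h.
  have -> : a / (x * y) ^+ 2 - b / y ^+ 2 = (a - x ^+ 2 * b) / (x ^+ 2 * y ^+ 2).
    by field; rewrite !lt0r_neq0.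
  rewrite normrM normfV [X in _ / X]gtr0_norm ?mulr_gt0 ?exprn_gt0 //.
  rewrite ler_pdivrMr ?mulr_gt0 ?exprn_gt0 //; apply: le_trans h _.
  rewrite le_eqVlt; apply/orP; left; apply/eqP; field.
  by rewrite !lt0r_neq0.
(* Both u m and u n are compared with u (m n). *)
have [|L hL] := @harmonic_limit R u K.
  move=> m n m0 n0; have := scale m n m0 n0; have := scale n m n0 m0.
  rewrite mulnC !ler_distl => /andP[h1 h2] /andP[h3 h4]; lra.
exists L => n; have [->|n0] := posnP n.
  by rewrite /count_box /box muln0 big_geq // expr0n mulr0 subrr normr0 mulr0.
have := hL n n0; rewrite /u; have := up _ n0.
move: (n%:R : R) (F n) => x a x0 h.
have -> : a - L * x ^+ 2 = (a / x ^+ 2 - L) * x ^+ 2 by field; rewrite lt0r_neq0.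
move: (a / x ^+ 2 - L) h => y h; rewrite normrM [X in _ * X]gtr0_norm ?exprn_gt0 // expr2 mulrA ler_wpM2r ?(ltW x0) //.
by rewrite -ler_pdivlMr.
Qed.

(** The factor 1 + ln n instead of ln n lets the bound hold from n = 1, where the logarithm
    vanishes. *)
Definition asymptotic (g : nat -> R) (c : R) :=
  exists C, forall n, (0 < n)%N -> `|g n - c * n%:R ^+ 2| <= C * (n%:R * (1 + ln n%:R)).

(** The limit is the product of 1 - p^-2 over the primes p not dividing [d]. Its positivity is
    obtained numerically, without the product. *)
Lemma coprime_density (d : nat) : (1 < d)%N ->
  exists2 k : R, 0 < k & forall n, (0 < n)%N ->
  `|\sum_(1 <= e < n.+1) (if coprime e d then (mobius e)%:~R / e%:R ^+ 2 else 0) - k| <= n%:R^-1.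
Proof.
move=> d1; pose a e : R := if coprime e d then (mobius e)%:~R / e%:R ^+ 2 else 0.
pose S n := \sum_(1 <= e < n.+1) a e; rewrite -/(S _).
have an e : `|a e| <= e%:R ^- 2.
  rewrite /a; case: ifP => _; last by rewrite normr0 invr_ge0 exprn_ge0.
  rewrite normrM [X in _ * X]ger0_norm ?invr_ge0 ?exprn_ge0 //.
  by rewrite -[X in _ <= X]mul1r ler_wpM2r ?invr_ge0 ?exprn_ge0 // mobius_abs.
have St m n : (0 < m <= n)%N -> `|S n - S m| <= m%:R^-1 - n%:R^-1.
  move=> /andP[m0 mn]; rewrite /S (big_cat_nat (n := m.+1)) //= [X in `|X|]addrC addKr.
  apply: le_trans (ler_norm_sum _ _ _) _.
  by apply: le_trans (sum_inv_sqr_tail R _); [exact: ler_sum|rewrite m0].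
have [|k hk] := @harmonic_limit R S 1.
  move=> m n m0 n0; rewrite !div1r.
  have vp i : (0 < i)%N -> 0 < i%:R^-1 :> R by rewrite invr_gt0 ltr0n.
  have := vp _ m0; have := vp _ n0.
  case: (leqP m n) => [mn|/ltnW nm] vn vm.
    by have /= := St m n; rewrite m0 mn => /(_ isT); rewrite ler_distl => /andP[]; lra.
  by have /= := St n m; rewrite n0 nm => /(_ isT); rewrite ler_distl => /andP[]; lra.
exists k => [|n n0]; last by have := hk n n0; rewrite div1r.
(* S 2 is at least 3/4, the terms from 3 to 8 amount to at most 1/2 - 1/8, and the remaining tail to
   at most 1/8, so k >= 1/4. *)
have := hk 8 isT; have := St 2 8 isT.
have -> : S 2 = 1 + a 2.
  by rewrite /S big_nat_recr //= big_nat1 /a coprime1n expr1n divr1.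
by have := an 2; rewrite !ler_norml => /andP[? ?] /andP[? ?] /andP[? ?]; lra.
Qed.
End Density.

(** * Coprime lattice points in a residue class *)

Section ClassCounting.
Variable R : realType.
Variables (s : seq (int * int * bool)) (P : nat -> nat -> nat -> bool).
Hypothesis hP : homogeneous s P.
Local Notation F := (count_box R P).
Local Notation K := (boundary_const R s).

Definition class_count (d i j n : nat) : R :=
  box (3 * n) (fun q b => (P n (d * q + i)%N (d * b + j)%N)%:R).

(** Cells of side [d] sampled at (i, j) pick out exactly the class of (i, j), so each of the d^2
    classes receives the same share. *)
Lemma class_density (d : nat) (L : R) :
  (forall n, `|F n - L * n%:R ^+ 2| <= K * n%:R) -> forall n i j, (i < d)%N -> (j < d)%N ->
  `|class_count d i j n - L / d%:R ^+ 2 * n%:R ^+ 2| <= 2 * K * n%:R.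
Proof.
move=> hL n i j id jd.
have [->|n0] := posnP n.
  by rewrite /class_count /box muln0 big_geq // expr0n mulr0 subrr normr0 mulr0.
have d1 : 1 <= d%:R :> R by rewrite ler1n; lia.
have d2 : 1 <= d%:R ^+ 2 :> R by rewrite exprn_ege1.
have nd : (n <= d * n)%N by rewrite leq_pmull; lia.
have := cell_count R hP n0 id jd nd; have := hL n.
rewrite -/(class_count d i j n).
have := boundary_const_ge0 R s; have : 0 <= n%:R :> R by [].
move: (class_count _ _ _ _) (F n) K (n%:R : R) d2 => f a k x; move: (d%:R ^+ 2) => y y1 x0 k0 h1 h2.
have y0 : 0 < y by lra.
have -> : f - L / y * x ^+ 2 = (y * f - L * x ^+ 2) / y by field; rewrite lt0r_neq0.
rewrite normrM normfV (gtr0_norm y0) ler_pdivrMr //.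
have -> : y * f - L * x ^+ 2 = (a - L * x ^+ 2) - (a - y * f) by ring.
apply: le_trans (ler_normB _ _) _; apply: le_trans (lerD h1 h2) _.
have kx : 0 <= k * x by rewrite mulr_ge0.
have : 0 <= (y - 1) * (k * x) by rewrite mulr_ge0 // subr_ge0.
lra.
Qed.

Definition coprime_class_count (d i j n : nat) : R :=
  box (3 * n) (fun q b => if (q %% d == i)%N && (b %% d == j)%N
                          then (P n q b && coprime q b)%:R else 0).

(** Dividing a point by [e] leads to the dilate by n/e rounded down and, [e] being invertible modulo
    [d], permutes the residue classes. *)
Lemma class_count_scaled (d i j e n : nat) :
  (0 < e)%N -> coprime e d -> (i < d)%N -> (j < d)%N ->
  exists i' j', [/\ (i' < d)%N, (j' < d)%N &
   box (3 * n) (fun q b => if (q %% e == 0)%N && (b %% e == 0)%N then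
    (if (q %% d == i)%N && (b %% d == j)%N then (P n q b)%:R else 0) else 0)
   = class_count d i' j' (n %/ e)].
Proof.
move=> e0 ed id jd; have [i' id' hi] := modn_mul_inv ed id.
have [j' jd' hj] := modn_mul_inv ed jd; exists i', j'; split=> //.
have supp N q b : (3 * N <= q)%N || (3 * N <= b)%N -> P N q b = false.
  by move=> h; apply/negP; case: hP => _ _ h' /h'; lia.
have d0 : (0 < d)%N by lia.
(* The boxes are enlarged to sides divisible by e, and later by d, at no cost because [P] vanishes
   outside. *)
rewrite -(box_extend (n := e * (3 * n))); first last.
- by move=> q b /supp ->; rewrite !if_same.
- exact: leq_pmull.
rewrite box_corner //.
have le_n : (3 * (n %/ e) <= d * (3 * n))%N.
  by apply: leq_trans (leq_pmull _ d0); rewrite leq_mul2l /= leq_div.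
transitivity (box (d * (3 * n)) (fun q b => if (q %% d == i')%N && (b %% d == j')%N then
    (P (n %/ e)%N q b)%:R else 0 : R)).
  rewrite (box_extend (m := 3 * n) (n := d * (3 * n))).
  - by apply: eq_box => q b _ _; rewrite !addn0 hi hj (homogeneous_scale _ _ _ hP).
  - exact: leq_pmull.
  - move=> q b h; rewrite supp ?if_same //; have := leq_div n e; lia.
rewrite box_corner // /class_count (box_extend (m := 3 * (n %/ e))) //.
- by rewrite leq_mul2l leq_div.
- move=> q b h; rewrite supp //; move: h.
  by case/orP => h; apply/orP; [left|right]; apply: (leq_trans h); nia.
Qed.

(** Moebius inversion over the common divisors e of q and b. They are prime to [d] because q is
    congruent to [i], and at most [n] because 0 < q <= n. *)
Lemma coprime_class_mobius (d i j n : nat) :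
  (1 < d)%N -> (i < d)%N -> (j < d)%N -> coprime i d ->
  coprime_class_count d i j n = \sum_(1 <= e < n.+1) (if coprime e d then
    (mobius e)%:~R * box (3 * n) (fun q b => if (q %% e == 0)%N && (b %% e == 0)%N then
    (if (q %% d == i)%N && (b %% d == j)%N then (P n q b)%:R else 0) else 0) else 0).
Proof.
move=> d1 id jd cid.
pose H e q b : R := if coprime e d then (mobius e)%:~R * (if (q %% e == 0)%N && (b %% e == 0)%N then
    (if (q %% d == i)%N && (b %% d == j)%N then (P n q b)%:R else 0) else 0) else 0.
transitivity (box (3 * n) (fun q b => \sum_(1 <= e < n.+1) H e q b)); last first.
  rewrite /box; under eq_bigr => q _ do rewrite exchange_big /=.
  rewrite exchange_big /=; apply: eq_bigr => e _; rewrite /H; case: ifP => _.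
    by rewrite mulr_sumr; apply: eq_bigr => q _; rewrite mulr_sumr.
  by rewrite big1 // => q _; rewrite big1.
apply: eq_box => q b _ _; rewrite /H.
case: ifPn => [/andP[qi bj]|_]; last by rewrite big1 // => e _; rewrite !if_same mulr0 if_same.
have [pq /=|_ /=] := boolP (P n q b); last by rewrite big1 // => e _; rewrite !if_same mulr0 if_same.
have /andP[/andP[q0 qn] _] : (0 < q <= n)%N && (b < 3 * n)%N by case: hP => _ _; apply.
have -> : (coprime q b)%:R = ((coprime q b)%:R : int)%:~R :> R by rewrite rmorph_nat.
rewrite (@sum_mobius_coprime q b n) ?q0 // rmorph_sum /= big_nat_recl // dvd0n (gtn_eqF q0) /= add0r.
rewrite big_add1 /=; apply: eq_big_nat => e /andP[e0 _].
rewrite -!/(dvdn _ _); case: ifPn => [/andP[eq eb]|_]; last by rewrite mulr0 if_same.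
rewrite mulr1 ifT //; apply: coprime_dvdl eq _.
by rewrite -coprime_modl (eqP qi).
Qed.

(** Moebius inversion reduces to [class_density] at n/e rounded down for each e. The last clause
    isolates the only input needed for a positive constant. *)
Lemma coprime_class_asymptotic (d i j : nat) :
  (1 < d)%N -> (i < d)%N -> (j < d)%N -> coprime i d ->
  exists c : R, [/\ 0 <= c, asymptotic (coprime_class_count d i j) c &
    (exists2 x : R, 0 < x & forall N, exists2 n, (N <= n)%N & x * n%:R ^+ 2 <= F n) -> 0 < c].
Proof.
move=> d1 id jd cid; have [L hL] := density R hP.
have [k k0 hk] := coprime_density R d1.
have K0 := boundary_const_ge0 R s.
have up n : (0 < n)%N -> 0 < n%:R :> R by rewrite ltr0n.
have d0 : 0 < d%:R ^+ 2 :> R by rewrite exprn_gt0 // ltr0n; lia.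
have F0 n : 0 <= F n by rewrite /count_box /box sumr_ge0 // => q _; rewrite sumr_ge0.
have big (x y : R) : 0 < x -> exists2 N, (0 < N)%N & forall n, (N <= n)%N -> y < x * n%:R.
  move=> x0; have [N hN] : exists N : nat, y / x < N%:R.
    exists (Num.truncn `|y / x|).+1; apply: le_lt_trans (ler_norm _) _.
    by rewrite truncnS_gt.
  exists N.+1 => // n Nn; rewrite mulrC -ltr_pdivrMr //; apply: lt_le_trans hN _.
  by rewrite ler_nat ltnW.
have L0 : 0 <= L.
  rewrite leNgt; apply/negP => L0; have [N N0 /(_ N (leqnn N)) h] := big (- L) K ltac:(lra).
  have := hL N; rewrite ler_distl => /andP[_ h1]; have F0N := F0 N; have N1 := up N N0.
  by move: (F N) F0N (N%:R : R) N1 h h1 => a a0 x x0 h h1; nra.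
(* A quadratic lower bound at arbitrarily large n excludes L <= 0, since F n - L n^2 is only
   O(n). *)
have Lpos : (exists2 x : R, 0 < x & forall N, exists2 n, (N <= n)%N & x * n%:R ^+ 2 <= F n) -> 0 < L.
  move=> [x x0 h]; rewrite ltNge; apply/negP => L0'.
  have [N N0 hN] := big x K x0; have [n Nn hn] := h N.
  have := hN n Nn; have := hL n; rewrite ler_distl => /andP[_ h1] h2.
  have n1 := up n (leq_trans N0 Nn).
  move: (F n) (n%:R : R) hn n1 h1 h2 => a y hn y0 h1 h2.
  have : 0 < y * (x * y - K) by rewrite mulr_gt0 // subr_gt0.
  have : 0 <= - L * y ^+ 2 by rewrite mulr_ge0 ?oppr_ge0 ?exprn_ge0 // ltW.
  by move=> ? ?; lra.
pose A := L / d%:R ^+ 2; have A0 : 0 <= A by rewrite divr_ge0 // ltW.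
exists (A * k); split; [by rewrite mulr_ge0 // ltW| |by move=> /Lpos h; rewrite !mulr_gt0 ?invr_gt0].
(* Here 2 K comes from counting in one class, 2 A from replacing the rounded n/e by n/e, and A from
   truncating the series for k. *)
exists (2 * K + 3 * A) => n n0; rewrite coprime_class_mobius //.
have n0' := up n n0.
have ln0 : 0 <= ln n%:R :> R by rewrite ln_ge0 // ler1n.
set S := (X in `|X - _|).
pose T : R := \sum_(1 <= e < n.+1) (if coprime e d then (mobius e)%:~R / e%:R ^+ 2 else 0).
have KA0 : 0 <= 2 * K + 2 * A by lra.
have h1 : `|T - k| <= n%:R^-1 by exact: hk.
(* The term e has an error O(n/e), and the harmonic sum produces the logarithm. *)
have h2 : `|S - A * n%:R ^+ 2 * T| <= (2 * K + 2 * A) * n%:R * (1 + ln n%:R).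
  apply: le_trans (ler_wpM2l _ (harmonic_sum_ln R n0)); last first.
    by rewrite mulr_ge0 // ltW.
  rewrite /S /T !mulr_sumr -sumrB; apply: le_trans (ler_norm_sum _ _ _) _.
  rewrite !big_nat; apply: ler_sum => e /andP[e0 _].
  have e0' := up e e0.
  have B0 : 0 <= (2 * K + 2 * A) * n%:R / e%:R.
    by rewrite !mulr_ge0 ?invr_ge0 // ltW.
  case: ifPn => ed; last by rewrite mulr0 subrr normr0.
  have [i' [j' [id' jd' ->]]] := class_count_scaled n e0 ed id jd.
  set f := class_count _ _ _ _.
  have -> : (mobius e)%:~R * f - A * n%:R ^+ 2 * ((mobius e)%:~R / e%:R ^+ 2) =
     (mobius e)%:~R * (f - A * (n%:R / e%:R) ^+ 2).
    by field; rewrite lt0r_neq0.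
  rewrite normrM -[X in _ <= X]mul1r; apply: ler_pM => //; first exact: mobius_abs.
  rewrite -[X in _ <= X]mulrA.
  have := class_density hL (n %/ e) id' jd'; rewrite -/f -/A.
  have lo : (n %/ e)%:R <= n%:R / e%:R :> R.
    by rewrite ler_pdivlMr // -natrM ler_nat leq_trunc_div.
  have hi : n%:R / e%:R <= (n %/ e)%:R + 1 :> R.
    by rewrite ler_pdivrMr // natr1 -natrM ler_nat ltnW // -ltn_divLR.
  move: (n%:R / e%:R) lo hi => y.
  have : 0 <= (n %/ e)%:R :> R by [].
  move: ((n %/ e)%:R : R) => x x0 xy yx h.
  have -> : f - A * y ^+ 2 = (f - A * x ^+ 2) + A * ((x - y) * (x + y)) by ring.
  apply: le_trans (ler_normD _ _) _; rewrite normrM (ger0_norm A0) [X in _ <= X]mulrDl.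
  apply: lerD; first by apply: le_trans h _; rewrite ler_wpM2l // mulr_ge0.
  have -> : 2 * A * y = A * (2 * y) by ring.
  by apply: ler_wpM2l => //; rewrite ler_norml; nra.
have -> : S - A * k * n%:R ^+ 2 = (S - A * n%:R ^+ 2 * T) + A * n%:R ^+ 2 * (T - k) by ring.
apply: le_trans (ler_normD _ _) _; apply: le_trans (lerD h2 (lexx _)) _.
have h3 : `|A * n%:R ^+ 2 * (T - k)| <= A * n%:R.
  rewrite normrM ger0_norm ?mulr_ge0 ?exprn_ge0 //.
  apply: le_trans (ler_wpM2l _ h1) _; first by rewrite mulr_ge0 // exprn_ge0.
  by rewrite le_eqVlt; apply/orP; left; apply/eqP; field; rewrite lt0r_neq0.
apply: le_trans (lerD (lexx _) h3) _.
have : 0 <= A * n%:R * ln n%:R by rewrite !mulr_ge0 // ltW.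
lra.
Qed.
End ClassCounting.

(** * Points between two fractions of determinant k *)

(** Coordinates (x, y) of vectors x v + y w strictly between v and v' = k w - r v: y is the
    determinant with v, and k x + r y the determinant with v'. The range is the one that suffices in
    [fanP]. *)
Definition offsets (k d r : nat) : seq (int * int) :=
  [seq p <- [seq (x%:Z - (k * d)%N%:Z, y%:Z) | x <- iota 0 (2 * (k * d)).+1, y <- iota 1 (k * d)]
     | 0 < k%:Z * p.1 + r%:Z * p.2].

Lemma mem_offsets (k d r : nat) (p : int * int) :
  (p \in offsets k d r) = [&& `|p.1| <= (k * d)%N%:Z, 0 < p.2, p.2 <= (k * d)%N%:Z
                           & 0 < k%:Z * p.1 + r%:Z * p.2].
Proof.
rewrite mem_filter andbC !andbA; congr (_ && _); case: p => x y; rewrite [(x, y).1]/= [(x, y).2]/=.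
apply/allpairsPdep/idP => [[i [j [hi hj [-> ->]]]]|h].
  by move: hi hj; rewrite !mem_iota; lia.
exists `|(x + (k * d)%N%:Z)%R|%N, `|y|%N; split; rewrite ?mem_iota; try lia.
congr (_, _); lia.
Qed.

(** The arguments [i] and [j] stand for q and b modulo [d]; for fixed [i] and [j] the condition is a
    combination of linear inequalities. The quantity k b - r q is the denominator of v'. *)
Definition fan (k d r i j n q b : nat) : bool :=
  [&& (0 < q)%N, (q <= n)%N, 0 < k%:Z * b%:Z - r%:Z * q%:Z,
      k%:Z * b%:Z - r%:Z * q%:Z <= n%:Z &
      all (fun p => coprime `|p.1 * i%:Z + p.2 * j%:Z| d ==> (n%:Z < p.1 * q%:Z + p.2 * b%:Z))
          (offsets k d r)].

Definition fan_atoms (k d r : nat) : seq (int * int * bool) :=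
  [:: ((1, 0), false); ((1, 0), true); ((- r%:Z, k%:Z), false); ((- r%:Z, k%:Z), true)]
  ++ [seq (p, true) | p <- offsets k d r].

Lemma fan_homogeneous (k d r i j : nat) : (0 < k)%N -> (r <= k)%N ->
  homogeneous (fan_atoms k d r) (fan k d r i j).
Proof.
move=> k0 rk; split.
- move=> t; rewrite mem_cat => /orP[|/mapP[p]].
    by rewrite !inE => /or4P[] /eqP -> /=; rewrite ?oner_eq0 //; lia.
  by rewrite mem_offsets => /and4P[_ h _ _] -> /=; lia.
- have fanE n q b : fan k d r i j n q b =
      [&& ~~ atom ((1, 0), false) n q b, atom ((1, 0), true) n q b,
          ~~ atom ((- r%:Z, k%:Z), false) n q b, atom ((- r%:Z, k%:Z), true) n q b &
          all (fun p => coprime `|p.1 * i%:Z + p.2 * j%:Z| d ==> ~~ atom (p, true) n q b)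
              (offsets k d r)].
    have aE t : atom t n q b = (t.1.1 * q%:Z + t.1.2 * b%:Z <= (t.2 * n)%N%:Z) by [].
    rewrite /fan !aE /= mul0n mul1n.
    do 4! [congr andb; first lia].
    by apply: eq_all => p; rewrite aE /= mul1n -ltNge.
  move=> n q b n' q' b' h; rewrite !fanE.
  rewrite !(h (_, _)) ?mem_cat ?inE ?eqxx ?orbT //.
  do 4! congr andb; apply: eq_in_all => p hp; rewrite h // mem_cat.
  by apply/orP; right; apply/mapP; exists p.
- move=> n q b /and5P[q0 qn h1 h2 _]; rewrite q0 qn /=.
  (* From k b <= n + r q and r <= k one gets b <= 2 n, which is below 3 n as n > 0. *)
  have : (k * b <= k * (2 * n))%N by nia.
  by rewrite leq_pmul2l //; lia.
Qed.

Lemma coprime_congr (u v w : int) (d : nat) : u = v + d%:Z * w -> coprime `|u| d = coprime `|v| d.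
Proof.
move=> ->; have E x : coprime `|x| d = (gcdz x d%:Z == 1) by rewrite /coprime /gcdz.
by rewrite !E gcdzC addrC mulrC gcdzMDl gcdzC.
Qed.

Lemma fan_mod (k d r n q b : nat) : fan k d r (q %% d) (b %% d) n q b = fan k d r q b n q b.
Proof.
rewrite /fan; do 4! congr andb; apply: eq_all => p; congr (_ ==> _).
apply/esym/(coprime_congr (w := p.1 * (q %/ d)%N%:Z + p.2 * (b %/ d)%N%:Z)).
by rewrite {1}(divn_eq q d) {1}(divn_eq b d) !PoszD !PoszM; ring.
Qed.

(* Subtracting multiples of [d] times the two generators of the cone from the point [X v + Y w]
   reduces it to a fundamental parallelogram, decreases its denominator, and preserves the
   denominator modulo [d]. *)
Lemma fanP (k d r n q b : nat) : (0 < k)%N -> (0 < d)%N -> (0 < r <= k)%N ->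
  reflect [/\ (0 < q <= n)%N, 0 < k%:Z * b%:Z - r%:Z * q%:Z, k%:Z * b%:Z - r%:Z * q%:Z <= n%:Z &
      forall X Y : int, 0 < Y -> 0 < k%:Z * X + r%:Z * Y ->
        coprime `|X * q%:Z + Y * b%:Z| d -> n%:Z < X * q%:Z + Y * b%:Z]
    (fan k d r q b n q b).
Proof.
move=> k0 d0 /andP[r0 rk].
apply: (iffP and5P) => [[q0 qn h1 h2 /allP h]|[/andP[q0 qn] h1 h2 h]]; split=> //; first exact/andP.
  move=> X Y Y0 s0 cop; set kd := (k * d)%N%:Z.
  have kd0 : 0 < kd by rewrite ltz_nat muln_gt0 k0.
  have step (y : int) : 0 < y -> exists2 j, 0 <= j & 0 < y - kd * j <= kd.
    move=> y0; exists ((y - 1) %/ kd)%Z; first by rewrite divz_ge0 //; lia.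
    have := divz_eq (y - 1) kd; have := modz_ge0 (y - 1) (lt0r_neq0 kd0).
    by have := ltz_pmod (y - 1) kd0; lia.
  have [j j0 /andP[y1 y2]] := step _ Y0.
  have [i i0 /andP[s1 s2]] := step _ s0.
  (* The generators are v = (1, 0) and v' = (-r, k) in the basis v, w. Removing d i and d j times
     them brings k x + r y and y into [1, k d]. *)
  pose y := Y - kd * j; pose x := X + r%:Z * d%:Z * j - d%:Z * i.
  have sE : k%:Z * x + r%:Z * y = k%:Z * X + r%:Z * Y - kd * i.
    by rewrite /x /y /kd PoszM; ring.
  have bE : X * q%:Z + Y * b%:Z = x * q%:Z + y * b%:Z
      + d%:Z * (j * (k%:Z * b%:Z - r%:Z * q%:Z) + i * q%:Z).
    by rewrite /x /y /kd PoszM; ring.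
  have xy : (x, y) \in offsets k d r.
    rewrite mem_offsets /= sE s1 y1 y2 !andbT -/kd.
    have ry : 0 < r%:Z * y by rewrite mulr_gt0.
    have ry2 : r%:Z * y <= k%:Z * kd by apply: ler_pM => //; exact: ltW.
    have h3 : k%:Z * x <= k%:Z * kd.
      have : 1 * kd <= k%:Z * kd by rewrite ler_pM2r.
      lia.
    have h4 : k%:Z * (- kd) <= k%:Z * x by lia.
    have kz : 0 < k%:Z :> int by [].
    by rewrite ler_norml -(ler_pM2l kz) h4 -(ler_pM2l kz).
  have /= := h _ xy; rewrite -(coprime_congr bE) cop /=.
  move=> /lt_le_trans; apply; rewrite bE lerDl.
  by rewrite mulr_ge0 // addr_ge0 // mulr_ge0 // ltW.
apply/allP => -[x y]; rewrite mem_offsets /= => /and4P[_ y0 _ s0].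
by apply/implyP; exact: h.
Qed.

Lemma le_sum_nat (R : numDomainType) (m n N : nat) (f : nat -> R) :
  (forall i, 0 <= f i) -> (m <= n <= N)%N ->
  \sum_(m <= i < n) f i <= \sum_(0 <= i < N) f i.
Proof.
move=> f0 /andP[mn nN]; rewrite (big_cat_nat (n := n) (leq0n n) nN) /=.
rewrite (big_cat_nat (n := m) (leq0n m) mn) /= -[leLHS]add0r -[leLHS]addr0.
by rewrite !lerD // sumr_ge0.
Qed.

(* For [r = 1] and [w = (v + v') / k] of denominator divisible by [d], the point [x v + y w] has
   denominator coprime to [d] only if [x != 0], and then its denominator exceeds that of [v + w]
   or [v' + w]. *)
Lemma fan_center (k d n q b N : nat) : (0 < k)%N -> (1 < d)%N -> n = ((k.+1 * k) * N)%N ->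
  (n - k * N < q <= n)%N -> (2 * k * N < b <= (2 * k).+1 * N)%N -> fan k d 1 1 0 n q b.
Proof.
move=> k0 d1 nE /andP[q1 q2] /andP[b1 b2].
have kb1 : (k * (2 * k * N).+1 <= k * b)%N by rewrite leq_mul2l b1 orbT.
have kb2 : (k * b <= k * ((2 * k).+1 * N))%N by rewrite leq_mul2l b2 orbT.
have kkN : (k * N <= k * (k * N))%N by rewrite leq_pmull.
have nE' : n = (k * (k * N) + k * N)%N by rewrite nE; ring.
have kbE : (k * (2 * k * N).+1 = 2 * (k * (k * N)) + k)%N by ring.
have kbE' : (k * ((2 * k).+1 * N) = 2 * (k * (k * N)) + k * N)%N by ring.
have bE : (2 * k * N = 2 * (k * N))%N by ring.
have h1 : 0 < k%:Z * b%:Z - 1%:Z * q%:Z by lia.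
have h2 : k%:Z * b%:Z - 1%:Z * q%:Z <= n%:Z by lia.
have h3 : n%:Z < k%:Z * b%:Z - q%:Z + b%:Z by lia.
apply/and5P; split=> //; first lia.
apply/allP => -[x y]; rewrite mem_offsets /= => /and4P[_ y0 _ s0].
apply/implyP; rewrite mulr1 mulr0 addr0 => cop.
have x0 : x != 0 by apply: contraTneq cop => ->; rewrite /coprime gcd0n; lia.
have b0 : 0 <= b%:Z :> int by [].
case: (ltP 0 x) => xs.
  have : 1 * q%:Z <= x * q%:Z by rewrite ler_wpM2r //; lia.
  have : 1 * b%:Z <= y * b%:Z by rewrite ler_wpM2r //; lia.
  lia.
have : (1 - k%:Z * x) * b%:Z <= y * b%:Z by rewrite ler_wpM2r //; lia.
have : 1 * (k%:Z * b%:Z - 1%:Z * q%:Z) <= (- x) * (k%:Z * b%:Z - 1%:Z * q%:Z).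
  by rewrite ler_wpM2r ?(ltW h1) //; lia.
have -> : (1 - k%:Z * x) * b%:Z = b%:Z + - x * (k%:Z * b%:Z - 1%:Z * q%:Z) - x * q%:Z by ring.
lia.
Qed.

(** For n = k (k + 1) N the rectangle of [fan_center] contains k N^2 points, that is n^2 / (k (k +
    1)^2). *)
Lemma fan_count_large (R : realType) (k d : nat) : (0 < k)%N -> (1 < d)%N ->
  exists2 x : R, 0 < x & forall N, exists2 n, (N <= n)%N &
    x * n%:R ^+ 2 <= count_box R (fan k d 1 1 0) n.
Proof.
move=> k0 d1; have kp : 0 < k%:R :> R by rewrite ltr0n.
exists ((k%:R * k.+1%:R ^+ 2)^-1); first by rewrite invr_gt0 mulr_gt0 // exprn_gt0.
move=> N; pose n := (k.+1 * k * N)%N; exists n; first by rewrite leq_pmull // muln_gt0.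
have nE' : n = (k * (k * N) + k * N)%N by rewrite /n; ring.
have kkN : (k * N <= k * (k * N))%N by rewrite leq_pmull.
have bE : (2 * k * N = 2 * (k * N))%N by ring.
have NN : (N <= k * N)%N by rewrite leq_pmull.
have qn : ((n - k * N).+1 <= n.+1 <= (3 * n).+1)%N by lia.
pose G q b : R := (fan k d 1 1 0 n q b)%:R.
have hom := fan_homogeneous d 1 0 k0 k0.
rewrite -(box_count R hom (leqnSn (3 * n))) /box.
apply: le_trans (le_sum_nat _ qn) => [|q]; last exact: sumr_ge0.
apply: (@le_trans _ _ (\sum_((n - k * N).+1 <= q < n.+1) N%:R)).
  rewrite sumr_const_nat (_ : (n.+1 - _ = k * N)%N); last lia.
  rewrite -mulrnA -mulr_natr /n !natrM le_eqVlt; apply/orP; left; apply/eqP.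
  by rewrite -natr1; field; rewrite natr1 !lt0r_neq0.
rewrite !big_nat; apply: ler_sum => q hq.
have bn : ((2 * k * N).+1 <= ((2 * k).+1 * N).+1 <= (3 * n).+1)%N by rewrite mulSn; lia.
apply: le_trans (le_sum_nat _ bn) => [|b]; last by [].
apply: (@le_trans _ _ (\sum_((2 * k * N).+1 <= b < ((2 * k).+1 * N).+1) 1)).
  by rewrite sumr_const_nat mulSn subSS addnK.
rewrite !big_nat; apply: ler_sum => b hb.
by rewrite (fan_center (N := N)).
Qed.

(** * Pairs of Farey fractions as lattice points *)

Lemma num_den_ratio (a q : int) : coprimez a q -> 0 < q ->
  numq (a%:~R / q%:~R) = a /\ denq (a%:~R / q%:~R) = q.
Proof.
move=> cop q0; rewrite coprimeq_num // coprimeq_den // gtr0_sg // mul1r.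
by rewrite gt_eqF // gtr0_norm.
Qed.

Lemma ltq_cross (x y : rat) : (x < y) = (numq x * denq y < numq y * denq x).
Proof. exact: lt_ratE. Qed.

Lemma mem_farey_coprime (Q d : nat) (x : rat) : x \in farey_coprime Q d =
  [&& 0 < numq x, numq x <= denq x, denq x <= Q%:Z & coprime `|denq x| d].
Proof.
rewrite !inE /=; have -> : (x \in [eta mem_seq (farey Q)]) = (x \in farey Q) by [].
rewrite !andbA; congr (_ && _); apply/imfset2P/idP => /=.
  move=> [q hq [a ha ->]]; move: hq ha; rewrite !inE !mem_iota /= => hq /andP[ha cop].
  have [||-> ->] := @num_den_ratio a%:Z q%:Z; rewrite ?ltz_nat; [exact: cop|lia|lia].
move=> h; have d0 := denq_gt0 x.
exists `|denq x|%N; first by rewrite mem_iota; lia.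
exists `|numq x|%N; first by rewrite !inE mem_iota coprime_num_den; lia.
rewrite -[LHS]divq_num_den; congr (_ / _); rewrite pmulrn; congr intmul; lia.
Qed.

Definition farey_pairs (Q d k : nat) : seq (rat * rat) :=
  [fset p in farey_coprime Q d `*` farey_coprime Q d |
        consecutive (farey_coprime Q d) p.1 p.2 &&
        (denq p.1 * numq p.2 - numq p.1 * denq p.2 == k%:Z)]%fset.

Lemma farey_pairsP (Q d k : nat) (p : rat * rat) : reflect
  [/\ p.1 \in farey_coprime Q d, p.2 \in farey_coprime Q d, p.1 < p.2,
      denq p.1 * numq p.2 - numq p.1 * denq p.2 = k%:Z &
      forall z, z \in farey_coprime Q d -> ~~ (p.1 < z < p.2)]
  (p \in farey_pairs Q d k).
Proof.
rewrite /farey_pairs; set F := farey_coprime Q d.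
have -> : (p \in [fset p in F `*` F | consecutive F p.1 p.2 &&
    (denq p.1 * numq p.2 - numq p.1 * denq p.2 == k%:Z)]%fset) =
  (p \in (F `*` F)%fset) && (consecutive F p.1 p.2 &&
    (denq p.1 * numq p.2 - numq p.1 * denq p.2 == k%:Z)) by rewrite inE.
rewrite in_fsetM /consecutive.
apply: (iffP idP) => [/andP[_ /andP[/and4P[h1 h2 h3 /forallP h] /eqP h4]]|[h1 h2 h3 h4 h]].
  by split=> // z hz; exact: (h [` hz]%fset).
rewrite h1 h2 h3 h4 eqxx !andbT /=; apply/forallP => z.
exact: h (fsvalP z).
Qed.

(** Coprimality of q and b allows completion to a basis v, w; that of r and [k] makes k w - r v
    primitive. The last two conditions make both denominators prime to [d]. *)
Definition fan_triple (Q d k : nat) (t : nat * (nat * nat)) : bool :=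
  let: (r, (q, b)) := t in
  [&& (0 < r)%N, coprime r k, fan k d r q b Q q b, coprime q b, coprime q d &
      coprime `|(k%:Z * b%:Z - r%:Z * q%:Z)%R| d].

(* [p = (v, v')] and [v' = k w - r v] for a vector [w] of first coordinate [b] completing [v] to
   a basis of the lattice *)
Definition fan_of (k : nat) (p : rat * rat) (t : nat * (nat * nat)) : Prop :=
  let: (r, (q, b)) := t in
  [/\ denq p.1 = q%:Z, k%:Z * b%:Z = denq p.2 + r%:Z * q%:Z &
    exists2 c : int, q%:Z * c - numq p.1 * b%:Z = 1 & k%:Z * c = numq p.2 + r%:Z * numq p.1].

Lemma small_multiple (u m v : int) : u = m * v -> `|u| < m -> u = 0.
Proof.
move=> ->; have [->|v0] := eqVneq v 0; first by rewrite mulr0.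
rewrite normrM => h; exfalso.
have m0 : 0 <= m by lia.
have : `|m| * 1 <= `|m| * `|v| by rewrite ler_wpM2l //; lia.
lia.
Qed.

(** The relation q c - a b = 1 determines the numerator a modulo q, and 0 < a <= q fixes it; c and
    then v' follow. *)
Lemma fan_of_inj (Q d k : nat) (p p' : rat * rat) t : (0 < k)%N ->
  p.1 \in farey_coprime Q d -> p'.1 \in farey_coprime Q d ->
  fan_of k p t -> fan_of k p' t -> p = p'.
Proof.
case: t => r [q b] k0; rewrite !mem_farey_coprime => /and4P[a0 aq _ _] /and4P[a0' aq' _ _].
case: p a0 aq => x y /= a0 aq; case: p' a0' aq' => x' y' /= a0' aq'.
move=> [xq yb [c det cE]] [xq' yb' [c' det' cE']].
have aE : numq x = numq x'.
  apply/eqP; rewrite -subr_eq0; apply/eqP.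
  apply: (@small_multiple _ q%:Z (c * (numq x - numq x') - numq x * (c - c'))); last lia.
  have E : numq x * b%:Z = q%:Z * c - 1 by lia.
  have E' : numq x' * b%:Z = q%:Z * c' - 1 by lia.
  rewrite -[LHS]mulr1 -det.
  have -> : (numq x - numq x') * (q%:Z * c - numq x * b%:Z) =
    q%:Z * c * (numq x - numq x') - numq x * (numq x * b%:Z) + numq x * (numq x' * b%:Z) by ring.
  by rewrite E E'; ring.
have cc : c = c'.
  have q0 : q%:Z != 0 by rewrite -xq denq_neq0.
  by apply: (mulfI q0); rewrite aE in det; lia.
have xx : x = x' by rewrite -(divq_num_den x) -(divq_num_den x') aE xq xq'.
congr (_, _) => //; rewrite -(divq_num_den y) -(divq_num_den y').
congr (_%:~R / _%:~R); first by rewrite aE cc in cE; lia.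
lia.
Qed.

(** Since k w = v' + r v with v primitive, r is determined modulo [k], hence in [1, k]. *)
Lemma fan_of_fun (k : nat) (p : rat * rat) r q b r' q' b' : (0 < k)%N ->
  (0 < r <= k)%N -> (0 < r' <= k)%N ->
  fan_of k p (r, (q, b)) -> fan_of k p (r', (q', b')) -> (r, (q, b)) = (r', (q', b')).
Proof.
move=> k0 hr hr' [xq yb [c det cE]] [xq' yb' [c' det' cE']].
have qq : q = q' by lia.
move: xq' yb' det' cE'; rewrite -qq => xq' yb' det' cE'.
have rr : r%:Z - r'%:Z = 0.
  apply: (@small_multiple _ k%:Z ((b%:Z - b'%:Z) * c - (c - c') * b%:Z)); last lia.
  rewrite -[LHS]mulr1 -det.
  have -> : k%:Z * ((b%:Z - b'%:Z) * c - (c - c') * b%:Z) =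
    (k%:Z * b%:Z - k%:Z * b'%:Z) * c - (k%:Z * c - k%:Z * c') * b%:Z by ring.
  by rewrite yb yb' cE cE'; ring.
have r_eq : r = r' by lia.
rewrite r_eq; congr (_, (_, _)).
have k1 : k%:Z != 0 by rewrite eqz_nat; lia.
suff : b%:Z = b'%:Z by lia.
by apply: (mulfI k1); rewrite yb yb' r_eq.
Qed.

Lemma fan_of_exists (Q d k : nat) (p : rat * rat) : (0 < k)%N -> (0 < d)%N ->
  p \in farey_pairs Q d k ->
  exists r q b, [/\ (r <= k)%N, (b < 3 * Q)%N, fan_triple Q d k (r, (q, b)) & fan_of k p (r, (q, b))].
Proof.
case: p => x y k0 d0 /farey_pairsP [/=]; rewrite !mem_farey_coprime.
move=> /and4P[a0 aq qQ qd] /and4P[a0' aq' qQ' qd'] xy det gap.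
have /coprimezP [[u v] /= uv] : coprimez (numq x) (denq x) by exact: coprime_num_den.
have q0 := denq_gt0 x; have q0' := denq_gt0 y.
move: (coprime_num_den y).
set a := numq x in a0 aq uv det *; set q := denq x in a0 aq qQ qd uv det q0 *.
set a' := numq y in a0' aq' det *; set q' := denq y in a0' aq' qQ' qd' det q0' *.
move=> cop'.
have kz : 0 < k%:Z :> int by [].
(* The Bezout vector (-u, v) completes the first fraction to a basis in which the second has
   coordinates s and k. *)
pose s := q' * v + a' * u.
(* The shift by 1 puts the remainder in [1, k] instead of [0, k - 1]. *)
pose j := ((- s - 1) %/ k%:Z)%Z; pose r := - s - k%:Z * j.
have rk : 0 < r <= k%:Z.
  rewrite /r /j; have := divz_eq (- s - 1) k%:Z.
  have := modz_ge0 (- s - 1) (lt0r_neq0 kz); have := ltz_pmod (- s - 1) kz; lia.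
pose b := - u - j * q; pose c := v - j * a.
have wdet : q * c - a * b = 1 by rewrite -uv /c /b; ring.
have kb : k%:Z * b = q' + r * q.
  have E : q' * (u * a + v * q) = q' by rewrite uv mulr1.
  by rewrite -[X in _ = X + _]E /r /s /b -det; ring.
have kc : k%:Z * c = a' + r * a.
  have E : a' * (u * a + v * q) = a' by rewrite uv mulr1.
  by rewrite -[X in _ = X + _]E /r /s /c -det; ring.
have rq : 0 < r * q by rewrite mulr_gt0 //; lia.
have b0 : 0 < b by rewrite -(pmulr_rgt0 _ kz) kb; lia.
exists `|r|%N, `|q|%N, `|b|%N.
have rE : `|r|%N%:Z = r by lia.
have qE : `|q|%N%:Z = q by lia.
have bE : `|b|%N%:Z = b by lia.
have fan_ok : fan k d `|r| `|q| `|b| Q `|q| `|b|.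
  apply/fanP => //; first lia.
  rewrite rE qE bE kb addrK; split; [lia|lia|lia|].
  move=> X Y Y0 s0 copB; rewrite ltNge; apply/negP => BQ.
  pose B := X * q + Y * b; pose A := X * a + Y * c.
  have B0 : 0 < B.
    have E : k%:Z * B = (k%:Z * X + r * Y) * q + Y * q'.
      have -> : k%:Z * B = X * q * k%:Z + Y * (k%:Z * b) by rewrite /B; ring.
      by rewrite kb; ring.
    by rewrite -(pmulr_rgt0 _ kz) E addr_gt0 // mulr_gt0.
  have lo : a * B < A * q.
    rewrite -subr_gt0; have -> : A * q - a * B = Y * (q * c - a * b) by rewrite /A /B; ring.
    by rewrite wdet mulr1.
  have hi : A * q' < a' * B.
    rewrite -subr_gt0.
    have -> : a' * B - A * q' = X * (q * a' - a * q') + Y * (a' * b - c * q') by rewrite /A /B; ring.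
    have -> : q' = k%:Z * b - r * q by lia.
    have -> : a' = k%:Z * c - r * a by lia.
    have -> : X * (q * (k%:Z * c - r * a) - a * (k%:Z * b - r * q)) +
       Y * ((k%:Z * c - r * a) * b - c * (k%:Z * b - r * q)) = (k%:Z * X + r * Y) * (q * c - a * b) by ring.
    by rewrite wdet mulr1.
  have A0 : 0 < A by rewrite -(pmulr_lgt0 _ q0); apply: le_lt_trans lo; rewrite ltW // mulr_gt0.
  have AB : A <= B.
    rewrite -(ler_pM2r q0'); apply: (le_trans (ltW hi)).
    by rewrite mulrC ler_wpM2l // ltW.
  move: lo hi A0 AB B0 BQ copB; rewrite -/B.
  (* A/B need not be in lowest terms; the reduced denominator divides B, so it is still at most Q
     and prime to d. *)
  case: (divqP A B) => [_|m z m0] lo hi A0 AB B0 BQ copB; first by rewrite ltxx in B0.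
  have z0 := denq_gt0 z.
  have mp : 0 < m by rewrite -(pmulr_lgt0 _ z0).
  have m1 : 1 <= m by lia.
  have le_m : 1 * denq z <= m * denq z by rewrite ler_pM2r.
  have zF : z \in farey_coprime Q d.
    rewrite mem_farey_coprime; apply/and4P; split.
    - by rewrite -(pmulr_rgt0 _ mp).
    - by rewrite -(ler_pM2l mp).
    - lia.
    - by apply: coprime_dvdl copB; rewrite abszM dvdn_mull.
  move/negP: (gap z zF); apply.
  rewrite !ltq_cross -/a -/q -/a' -/q' -(ltr_pM2l mp) -[X in _ && X](ltr_pM2l mp).
  by apply/andP; split; [rewrite [ltLHS]mulrCA [ltRHS]mulrA|rewrite [ltLHS]mulrA [ltRHS]mulrCA].
split; first lia.
- have : k%:Z * b <= k%:Z * (2 * Q%:Z).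
    have h1 : r * q <= k%:Z * Q%:Z by apply: ler_pM; lia.
    have : 1 * Q%:Z <= k%:Z * Q%:Z by rewrite ler_wpM2r.
    lia.
  by rewrite ler_pM2l //; lia.
- rewrite /fan_triple fan_ok rE qE bE kb addrK qd qd' /= !andbT; apply/and3P; split; first lia.
    (* A common divisor of r and k divides both coordinates of k w - r v. *)
    rewrite /coprime -dvdn1 -(eqP cop') dvdn_gcd.
    have gr : (gcdn `|r| k %| r)%Z by exact: dvdn_gcdl.
    have gk : (gcdn `|r| k %| k%:Z)%Z by exact: dvdn_gcdr.
    have a'E : a' = k%:Z * c - r * a by lia.
    have q'E : q' = k%:Z * b - r * q by lia.
    have : (gcdn `|r| k %| a')%Z by rewrite a'E rpredB ?dvdz_mulr.
    have : (gcdn `|r| k %| q')%Z by rewrite q'E rpredB ?dvdz_mulr.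
    by rewrite !dvdzE /= => -> ->.
  by apply/(coprimezP q b); exists (c, - a); rewrite /= -wdet; ring.
- by split; rewrite ?rE ?qE ?bE //; exists c.
Qed.

(* The hypotheses [1 < q] and [k <= k b - r q] ensure that the second fraction is at most [1].
   *)
Lemma farey_pair_of_fan (Q d k r q b : nat) : (0 < k)%N -> (0 < d)%N -> (r <= k)%N ->
  fan_triple Q d k (r, (q, b)) -> (1 < q)%N -> k%:Z <= k%:Z * b%:Z - r%:Z * q%:Z ->
  exists2 p, p \in farey_pairs Q d k & fan_of k p (r, (q, b)).
Proof.
move=> k0 d0 rk /and5P[r0 rcop + qb /andP[qd qd']] q1 q'k.
have rk' : (0 < r <= k)%N by rewrite r0.
move=> /(fanP Q q b k0 d0 rk') [/andP[q0 qQ] q'0 q'Q gap].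
have /coprimezP [[u v] /= uv] : coprimez q%:Z b%:Z by exact: qb.
have /coprimezP [[s t] /= st] : coprimez r%:Z k%:Z by exact: rcop.
have qz : 0 < q%:Z :> int by [].
(* The numerator is -v modulo q, shifted into [1, q]. *)
pose j := ((- v - 1) %/ q%:Z)%Z; pose a := - v - q%:Z * j; pose c := u - b%:Z * j.
have aq : 0 < a <= q%:Z.
  rewrite /a /j; have := divz_eq (- v - 1) q%:Z.
  have := modz_ge0 (- v - 1) (lt0r_neq0 qz); have := ltz_pmod (- v - 1) qz; lia.
have det : q%:Z * c - a * b%:Z = 1 by rewrite -uv /c /a; ring.
set q' := k%:Z * b%:Z - r%:Z * q%:Z in q'k q'0 q'Q qd' gap *.
pose a' := k%:Z * c - r%:Z * a.
have det' : q%:Z * a' - a * q' = k%:Z.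
  by rewrite -[RHS]mulr1 -det /a' /q'; ring.
(* With a < q and k <= q', the identity q a' = a q' + k gives a' <= q'. *)
have a_lt : a <= q%:Z - 1.
  have : a != q%:Z; last lia.
  apply/eqP => aE; move: det; rewrite aE -mulrBr => h.
  have : (q%:Z %| 1)%Z by apply/dvdzP; exists (c - b%:Z); rewrite mulrC.
  by rewrite dvdzE /= dvdn1; lia.
have a'0 : 0 < a'.
  rewrite -(pmulr_rgt0 _ qz); have : 0 < a * q' by rewrite mulr_gt0 //; lia.
  lia.
have a'q' : a' <= q'.
  rewrite -(ler_pM2l qz); have : a * q' <= (q%:Z - 1) * q' by rewrite ler_pM2r.
  lia.
have cop : coprimez a q%:Z by apply/coprimezP; exists (- b%:Z, c); rewrite /= -det; ring.
have cop' : coprimez a' q'.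
  apply/coprimezP; exists (t * q%:Z + s * b%:Z, - t * a - s * c) => /=.
  have -> : (t * q%:Z + s * b%:Z) * a' + (- t * a - s * c) * q' =
    (s * r%:Z + t * k%:Z) * (q%:Z * c - a * b%:Z) by rewrite /a' /q'; ring.
  by rewrite det st.
have [nx dx] := num_den_ratio cop qz; have [ny dy] := num_den_ratio cop' q'0.
exists (a%:~R / q%:~R, a'%:~R / q'%:~R); last first.
  by split; rewrite /= ?dx ?dy ?nx ?ny /q' ?subrK //; exists c; rewrite // /a' subrK.
apply/farey_pairsP => /=; rewrite !mem_farey_coprime ltq_cross nx ny dx dy.
split=> //; [by apply/and4P; split=> //; lia|by apply/and4P; split| |].
  by rewrite -subr_gt0; have -> : a' * q%:Z - a * q' = k%:Z by rewrite -det'; ring.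
move=> z; rewrite mem_farey_coprime => /and4P[_ _ zQ zd].
rewrite !ltq_cross nx ny dx dy; apply/negP => /andP[lo hi].
(* These are the coordinates of z in the basis v, w. *)
pose Y := q%:Z * numq z - a * denq z; pose X := c * denq z - b%:Z * numq z.
have B : X * q%:Z + Y * b%:Z = denq z.
  by rewrite -[RHS]mul1r -det /X /Y; ring.
have Y0 : 0 < Y by rewrite /Y; lia.
have X0 : 0 < k%:Z * X + r%:Z * Y.
  have -> : k%:Z * X + r%:Z * Y = a' * denq z - numq z * q' by rewrite /X /Y /a' /q'; ring.
  lia.
by have := gap X Y Y0 X0; rewrite B => /(_ zd); rewrite ltNge zQ.
Qed.

(** The injection is given as a relation, so that [fan_of] serves in both directions without a
    choice of functions. *)
Lemma size_le_rel (A B : eqType) (s : seq A) (t : seq B) (rel : A -> B -> Prop) :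
  uniq s -> (forall x, x \in s -> exists2 y, y \in t & rel x y) ->
  (forall x x' y, x \in s -> x' \in s -> rel x y -> rel x' y -> x = x') ->
  (size s <= size t)%N.
Proof.
elim: s t => [//|x s IH] t /= /andP[xs us] ex inj.
have [y yt xy] := ex x (mem_head x s).
have t0 : (0 < size t)%N by case: t yt {ex}.
rewrite -(prednK t0) ltnS -(size_rem yt); apply: IH => // [x' x's|x1 x2 y' h1 h2].
  have [|y' y't x'y'] := ex x'; first by rewrite inE x's orbT.
  exists y' => //; have : y' != y.
    apply: contraNneq xs => E; rewrite E in x'y'.
    by rewrite (inj x x' y) ?inE ?eqxx ?x's ?orbT.
  by move: y't; rewrite (perm_mem (perm_to_rem yt)) inE => /predU1P[->|//]; rewrite eqxx.
by apply: inj; rewrite inE ?h1 ?h2 orbT.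
Qed.

Definition triples (k B : nat) : seq (nat * (nat * nat)) :=
  [seq (r, z) | r <- iota 0 k.+1, z <- [seq (q, b) | q <- iota 0 B, b <- iota 0 B]].

Lemma mem_triples k B r q b :
  ((r, (q, b)) \in triples k B) = [&& (r <= k)%N, (q < B)%N & (b < B)%N].
Proof.
apply/allpairsP/idP => [[[r' z] [/= hr hz [-> zE]]]|/and3P[hr hq hb]].
  move: hz; rewrite -zE => /allpairsP[[q' b'] [/= hq hb [-> ->]]].
  by move: hr hq hb; rewrite -[0%N :: _]/(iota 0 k.+1) !mem_iota; lia.
exists (r, (q, b)); split; rewrite ?mem_iota ?add0n //.
by apply/allpairsP; exists (q, b); rewrite !mem_iota !add0n.
Qed.

Lemma triples_uniq k B : uniq (triples k B).
Proof.
apply: allpairs_uniq; rewrite ?iota_uniq //; last by move=> [? ?] [? ?].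
by apply: allpairs_uniq; rewrite ?iota_uniq // => -[? ?] [? ?].
Qed.

Lemma size_triples (R : numDomainType) k B (p : pred (nat * (nat * nat))) :
  (size [seq t <- triples k B | p t])%:R =
  \sum_(0 <= r < k.+1) box B (fun q b => (p (r, (q, b)))%:R) :> R.
Proof.
rewrite size_filter -sum1_count big_mkcond natr_sum big_allpairs /index_iota subn0.
apply: eq_bigr => r _; rewrite big_allpairs /box /index_iota subn0.
by apply: eq_bigr => q _; apply: eq_bigr => b _; case: (p _).
Qed.

(** * Summation over residue classes *)

Section Assembly.
Variable R : realType.

(** The predicate [pos] marks summands known to have a positive constant; one of them is enough, as
    the others are nonnegative. *)
Lemma asymptotic_sum (I : eqType) (s : seq I) (pos : pred I) (g : I -> nat -> R) :
  (forall i, i \in s -> exists c : R, [/\ 0 <= c, asymptotic (g i) c & pos i -> 0 < c]) ->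
  exists c : R, [/\ 0 <= c, asymptotic (fun n => \sum_(i <- s) g i n) c & has pos s -> 0 < c].
Proof.
elim: s => [_|i s IH h].
  exists 0; split=> //; exists 0 => n _.
  by rewrite big_nil mul0r subrr normr0 mul0r.
have [c [c0 [C hC] cpos]] := h i (mem_head i s).
have [|e [e0 [E hE] epos]] := IH; first by move=> l ls; apply: h; rewrite inE ls orbT.
exists (c + e); split; first exact: addr_ge0.
  exists (C + E) => n n0; rewrite big_cons.
  have -> : g i n + \sum_(i <- s) g i n - (c + e) * n%:R ^+ 2 =
    (g i n - c * n%:R ^+ 2) + (\sum_(i <- s) g i n - e * n%:R ^+ 2) by ring.
  by apply: le_trans (ler_normD _ _) _; rewrite mulrDl lerD ?hC ?hE.
by move=> /= /orP[/cpos h1|/epos h1]; [rewrite ltr_pwDl|rewrite ltr_wpDl].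
Qed.

Lemma asymptotic_near (g h : nat -> R) (c C : R) : 0 <= C ->
  (forall n, (0 < n)%N -> `|h n - g n| <= C * n%:R) -> asymptotic g c -> asymptotic h c.
Proof.
move=> C0 hg [E hE]; exists (E + C) => n n0.
have -> : h n - c * n%:R ^+ 2 = (g n - c * n%:R ^+ 2) + (h n - g n) by ring.
apply: le_trans (ler_normD _ _) _; rewrite mulrDl lerD ?hE //.
apply: le_trans (hg n n0) _; rewrite ler_wpM2l // -[leLHS]mulr1 ler_wpM2l //.
by rewrite lerDl ln_ge0 // ler1n.
Qed.

Lemma asymptotic_bigO (h : nat -> R) (c : R) : asymptotic h c ->
  (fun n : nat => h n - c * n%:R ^+ 2 : R) =O_\oo (fun n : nat => n%:R * ln (n%:R : R) : R).
Proof.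
move=> [C hC]; have ln2 : 0 < ln (2 : R) by rewrite ln_gt0 // ltr1n.
(* For n >= 2, 1 <= ln n / ln 2 absorbs the summand 1 into the logarithm. *)
apply/eqO_exP; exists ((`|C| + 1) * ((ln 2)^-1 + 1)).
  by rewrite mulr_gt0 // ?addr_gt0 ?invr_gt0 // ltr_wpDl.
near=> n.
have n2 : (2 <= n)%N by near: n; exists 2%N.
have n0 : 0 < n%:R :> R by rewrite ltr0n; lia.
have lnn : ln 2 <= ln (n%:R : R) by rewrite ler_ln ?posrE // ?ltr0n // ler_nat.
have lp : 0 <= ln (n%:R : R) by lra.
rewrite [X in _ <= _ * X]ger0_norm; last by rewrite mulr_ge0 // ltW.
apply: le_trans (hC n _) _; first lia.
apply: (@le_trans _ _ ((`|C| + 1) * (n%:R * (1 + ln n%:R)))).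
  rewrite ler_wpM2r ?mulr_ge0 ?addr_ge0 //.
  by apply: le_trans (ler_norm C) _; rewrite lerDl.
rewrite -mulrA ler_wpM2l ?addr_ge0 // mulrCA ler_wpM2l //.
rewrite mulrDl mul1r lerD2r -(ler_pM2l ln2) mulr1 mulrA mulfV ?mul1r //.
exact: lt0r_neq0.
Unshelve. all: by end_near.
Qed.

(** The triples are split by r and by the classes of q and b modulo [d], on each of which all
    coprimality to [d] is constant. *)
Lemma fan_triples_asymptotic (d k : nat) : (1 < d)%N -> (0 < k)%N ->
  exists2 c : R, 0 < c &
    asymptotic (fun n => (size [seq t <- triples k (3 * n) | fan_triple n d k t])%:R) c.
Proof.
move=> d1 k0; have d0 : (0 < d)%N by lia.
pose adm r i j := [&& (0 < r)%N, coprime r k, coprime i d & coprime `|(k%:Z * j%:Z - r%:Z * i%:Z)%R| d].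
pose g r i j n : R := if adm r i j then coprime_class_count R (fan k d r i j) d i j n else 0.
have gE r n : box (3 * n) (fun q b => (fan_triple n d k (r, (q, b)))%:R : R) =
    \sum_(0 <= i < d) \sum_(0 <= j < d) g r i j n.
  rewrite (box_classes _ _ d0); apply: eq_bigr => i _; apply: eq_bigr => j _.
  transitivity (box (3 * n) (fun q b => if (q %% d == i)%N && (b %% d == j)%N then
      (if adm r i j then (fan k d r i j n q b && coprime q b)%:R else 0) else 0 : R)).
    apply: eq_box => q b _ _; case: ifP => // /andP[/eqP <- /eqP <-].
    rewrite /adm fan_mod coprime_modl.
    rewrite -(coprime_congr (u := k%:Z * b%:Z - r%:Z * q%:Z)
      (w := k%:Z * (b %/ d)%N%:Z - r%:Z * (q %/ d)%N%:Z)); last first.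
      by rewrite {1}(divn_eq q d) {1}(divn_eq b d) !PoszD !PoszM; ring.
    rewrite /fan_triple; case: (0 < r)%N; case: (coprime r k); case: (coprime q d) => //=;
      case: (coprime _ d) => //=; rewrite ?andbT ?andbF //.
  rewrite /g; case: (adm r i j) => //.
  by rewrite /box big1 // => q _; rewrite big1 // => b _; rewrite if_same.
have gA r i j : (r <= k)%N -> (i < d)%N -> (j < d)%N ->
    exists c : R, [/\ 0 <= c, asymptotic (g r i j) c &
      [&& r == 1, i == 1 & j == 0]%N -> 0 < c].
  move=> rk id jd; have [ok|no] := boolP (adm r i j); last first.
    exists 0; split=> //; first by exists 0 => n _; rewrite /g (negbTE no) mul0r subrr normr0 mul0r.
    (* The case r = 1, i = 1, j = 0 is always admissible, since k j - r i = -1. *)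
    move=> /and3P[/eqP rE /eqP iE /eqP jE]; move: no.
    by rewrite /adm rE iE jE !coprime1n mulr0 sub0r abszN mulr1 /= coprime1n.
  have /and4P[_ _ cid _] := ok.
  have [c [c0 cA cpos]] := coprime_class_asymptotic R (fan_homogeneous d i j k0 rk) d1 id jd cid.
  exists c; split=> //; first by rewrite /g ok.
  by move=> /and3P[/eqP rE /eqP iE /eqP jE]; apply: cpos; rewrite rE iE jE; exact: fan_count_large.
have [|c [_ [C hC] cpos]] := @asymptotic_sum _ (index_iota 0 k.+1) (pred1 1%N)
    (fun r n => \sum_(0 <= i < d) \sum_(0 <= j < d) g r i j n).
  move=> r; rewrite mem_index_iota ltnS => /= rk.
  have [|c [c0 cA cpos]] := @asymptotic_sum _ (index_iota 0 d) (fun i => (r == 1) && (i == 1))%N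
      (fun i n => \sum_(0 <= j < d) g r i j n).
    move=> i; rewrite mem_index_iota => /= id.
    have [|c [c0 cA cpos]] := @asymptotic_sum _ (index_iota 0 d)
        (fun j => [&& r == 1, i == 1 & j == 0])%N (fun j n => g r i j n).
      by move=> j; rewrite mem_index_iota => /= jd; exact: gA.
    exists c; split=> // /andP[r1 i1]; apply: cpos; apply/hasP; exists 0%N.
      by rewrite mem_index_iota.
    by rewrite r1 i1.
  exists c; split=> // r1; apply: cpos; apply/hasP; exists 1%N.
    by rewrite mem_index_iota.
  by rewrite (r1 : r == 1%N).
exists c; first by apply: cpos; apply/hasP; exists 1%N => //; rewrite mem_index_iota.
by exists C => n n0; rewrite size_triples; under eq_bigr => r _ do rewrite gE; exact: hC.
Qed.

End Assembly.

(** * Comparison of Farey pairs with triples *)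

Lemma box_le_rows (R : numDomainType) (B : nat) (p : nat -> nat -> bool) :
  (forall q, \sum_(0 <= b < B) (p q b)%:R <= 1%:R :> R) -> box B (fun q b => (p q b)%:R : R) <= B%:R.
Proof.
move=> h; apply: le_trans (ler_sum _ _) _; first by move=> q _; exact: h.
by rewrite sumr_const_nat subn0.
Qed.

Lemma fan_triple_gt0 (Q d k r q b : nat) : fan_triple Q d k (r, (q, b)) ->
  [/\ (0 < r)%N, (0 < q <= Q)%N & 0 < k%:Z * b%:Z - r%:Z * q%:Z].
Proof. by case/and5P=> r0 _ /and5P[-> -> h _ _] _ _. Qed.

Definition proper_triple (k : nat) (t : nat * (nat * nat)) : bool :=
  (1 < t.2.1)%N && (k%:Z <= k%:Z * t.2.2%:Z - t.1%:Z * t.2.1%:Z).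

(** Either q = 1 or 0 < k b - r q < k. For given r, each case leaves one coordinate free and at most
    one value for the other, hence at most 3 Q points. *)
Lemma improper_count (R : numDomainType) (Q d k : nat) :
  (size [seq t <- triples k (3 * Q) | fan_triple Q d k t && ~~ proper_triple k t])%:R
    <= (6 * k.+1)%:R * Q%:R :> R.
Proof.
have [->|k0] := posnP k.
  rewrite size_triples big1 => [|r _]; first by rewrite mulr_ge0.
  rewrite /box big1 // => q _; rewrite big1 // => b _.
  case: (boolP (fan_triple _ _ _ _)) => // /fan_triple_gt0[_ _ h]; exfalso.
  have : 0 <= r%:Z * q%:Z by [].
  lia.
rewrite size_triples.
apply: (@le_trans _ _ (\sum_(0 <= r < k.+1) (6 * Q)%:R)); last first.
  by rewrite sumr_const_nat subn0 -mulrnA -natrM mulnAC.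
apply: ler_sum => r _.
have -> : (6 * Q)%:R = (3 * Q)%:R + (3 * Q)%:R :> R by rewrite -natrD; congr (_%:R); lia.
apply: (@le_trans _ _ (box (3 * Q) (fun q b => (q == 1)%N%:R) +
    box (3 * Q) (fun q b => (0 < k%:Z * b%:Z - r%:Z * q%:Z < k%:Z)%R%:R))).
  rewrite /box -big_split; apply: ler_sum => q _; rewrite -big_split; apply: ler_sum => b _.
  cbv beta; rewrite [leRHS]/= -natrD ler_nat; case: (boolP (fan_triple _ _ _ _)) => // /fan_triple_gt0[_ q0 ->].
  rewrite /proper_triple /=; case: (ltngtP q 1%N) => q1 /=; [lia| |by rewrite leq_addr].
  by rewrite -ltNge.
apply: lerD; last first.
  apply: box_le_rows => q; apply: count_diameter => i j /andP[i1 i2] /andP[j1 j2] ij.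
  rewrite addn0 leqNgt; apply/negP => ij'.
  have : k%:Z * (i%:Z + 1) <= k%:Z * j%:Z by rewrite ler_wpM2l //; lia.
  lia.
rewrite /box exchange_big; apply: (box_le_rows (p := fun b q => q == 1%N)) => b.
by apply: count_diameter => i j /eqP -> /eqP ->.
Qed.

(** Every Farey pair yields a triple and every proper triple yields a pair, so the two counts differ
    by at most the number of improper triples. *)
Lemma farey_count_near (R : realType) (d k n : nat) : (0 < d)%N -> (0 < k)%N ->
  `|(farey_count n d k)%:R - (size [seq t <- triples k (3 * n) | fan_triple n d k t])%:R|
    <= (6 * k.+1)%:R * n%:R :> R.
Proof.
move=> d0 k0; have -> : farey_count n d k = size (farey_pairs n d k) by [].
set T := [seq t <- _ | _].
have fstF p : p \in farey_pairs n d k -> p.1 \in farey_coprime n d by case/farey_pairsP.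
have up : (size (farey_pairs n d k) <= size T)%N.
  apply: (size_le_rel (rel := fan_of k)) => [|p pS|p p' t pS p'S h h'].
  - exact: fset_uniq.
  - have [r [q [b [rk b3 ok fo]]]] := fan_of_exists k0 d0 pS.
    exists (r, (q, b)) => //; rewrite mem_filter ok mem_triples rk b3 /= andbT.
    by have [_ + _] := fan_triple_gt0 ok; lia.
  - exact: fan_of_inj k0 (fstF _ pS) (fstF _ p'S) h h'.
have lo : (size [seq t <- T | proper_triple k t] <= size (farey_pairs n d k))%N.
  apply: (size_le_rel (rel := fun t p => fan_of k p t)).
  - by rewrite !filter_uniq // triples_uniq.
  - move=> [r [q b]]; rewrite !mem_filter mem_triples => /andP[/andP[q1 q'k] /andP[ok /and3P[rk _ _]]].
    exact: farey_pair_of_fan.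
  - move=> [r [q b]] [r' [q' b']] p; rewrite !mem_filter !mem_triples.
    move=> /andP[_ /andP[/fan_triple_gt0[r0 _ _] /andP[rk _]]].
    move=> /andP[_ /andP[/fan_triple_gt0[r0' _ _] /andP[rk' _]]].
    by apply: fan_of_fun; rewrite ?r0 ?r0'.
have := improper_count R n d k.
have := count_predC (proper_triple k) T; rewrite -!size_filter.
have -> : [seq t <- T | predC (proper_triple k) t] =
  [seq t <- triples k (3 * n) | fan_triple n d k t && ~~ proper_triple k t].
  by rewrite /T -filter_predI; apply: eq_filter => t /=; rewrite andbC.
move=> TE; apply: le_trans; rewrite distrC -natrB // ger0_norm // ler_nat.
by rewrite -TE leq_subLR leq_add2r.
Qed.

Theorem theorem1 (R : realType) (d k : nat) (hd : (1 < d)%N) (hk : (0 < k)%N) :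
  exists c : R, 0 < c /\
    (fun Q : nat => (farey_count Q d k)%:R - c * Q%:R ^+ 2 : R) =O_\oo
      (fun Q : nat => Q%:R * ln (Q%:R : R) : R).
Proof.
have [c c0 hc] := fan_triples_asymptotic R hd hk.
exists c; split=> //; apply: asymptotic_bigO.
apply: asymptotic_near hc => [|n _]; last by apply: farey_count_near => //; exact: ltnW.
by [].
Qed.
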